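(* Let $a$ be a Barker sequence of even length $n \geq 4$ such that $C_{1}=C_{3}=\cdots=C_{\frac{n}{2}-1}$, i.e. the aperiodic autocorrelations $C_k$ with $k$ odd and $1 \le k \le \frac{n}{2}-1$ are all equal. Then $n=4$.
   Context: For an integer $n>1$, a binary sequence of length $n$ is an element $a=(a_1,\dots,a_n)$ of $\{-1,1\}^n$. For $k=0,1,\dots,n-1$ its $k$th aperiodic autocorrelation is $C_k=C_k(a)=\sum_{j=1}^{n-k}a_ja_{j+k}$. A binary sequence $a$ of length $n$ is a Barker sequence if $C_k(a)\in\{-1,0,1\}$ for every $1\le k\le n-1$. (A Barker sequence of even length $n\ge 4$ has $n=4r^2$ for some positive integer $r$; in particular $n$ is a multiple of $4$, so $\frac n2-1$ is odd.) *)

(* Defs.v *)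
From mathcomp Require Import all_boot all_order all_algebra.
Set Implicit Arguments.
Unset Strict Implicit.
Unset Printing Implicit Defensive.
Import Order.TTheory GRing.Theory Num.Theory.

Local Open Scope ring_scope.

(* Entries are indexed from 0: the entry usually written a_j is a`_(j - 1). *)
Definition binary_sequence (n : nat) (a : n.-tuple int) : Prop :=
  forall x : int, x \in a -> x \in [:: -1; 1].

Definition autocorrelation (n : nat) (a : n.-tuple int) (k : nat) : int :=
  \sum_(0 <= j < n - k) a`_j * a`_(j + k)%N.

Definition barker_sequence (n : nat) (a : n.-tuple int) : Prop :=
  binary_sequence a /\
  forall k : nat, (1 <= k <= n - 1)%N ->
    autocorrelation a k \in [:: -1; 0; 1].

(* Main.v *)
Require Import Defs.
From mathcomp Require Import all_boot all_order all_algebra.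
From mathcomp Require Import zify ring.
Set Implicit Arguments.
Unset Strict Implicit.
Unset Printing Implicit Defensive.
Import Order.TTheory GRing.Theory Num.Theory.
Local Open Scope ring_scope.

(** Write n = 2m and A(z) = a_1 + a_2 z + ... + a_n z^(n-1).

    A sum of N signs is congruent mod 4 to N - 1 plus the product of those
    signs, so every C_k determines the product of the a_j a_(j+k), and two
    consecutive such products differ by the factor a_(k+1) a_(n-k).  For a
    Barker sequence of even length this gives that 4 divides n, that C_k = 0 for
    even k > 0 and that C_(n-k) = - C_k.  If moreover C_k = c for all odd k < m,
    the entries satisfy a_(n-k) = - c (-1)^k a_(k+1) for 0 <= k < m
    ([reflection]): the second half of the sequence is a signed mirror image of
    the first.

    Let B be the polynomial of the first half and B* its reciprocal polynomial.
    The mirror symmetry splits A(z) A*(z), whose coefficients are the C_k, into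
    an even part governed by B(z) B(-z) and an odd part governed by B(z) B*(z)
    ([fold_correlation]).  Inserting the known C_k gives
      (1 - z^2) B(z) B(-z) = (1 - z^m)^2                    ([barker_mulN]),
      B(z) B*(z) - B(-z) B*(-z) = 2m z^(m-1)                ([barker_mulr]).

    The second identity shows that B(z) and B(-z) are coprime over the
    rationals.  The first shows that B vanishes at some e in {1, -1}, and then
    U(z) = (z - e) B(z) satisfies U(z) U(-z) = (1 - z^m)^2 with coprime factors.
    So U is, up to sign, the square of an integer polynomial g.  The inner
    coefficients of U lie in {-2, 0, 2}, while the linear coefficient of g^2 is
    divisible by 4 as soon as its quadratic coefficient is even
    ([sqr_poly_coef1_mod4]).  For m > 2 the two extreme inner coefficients of U
    therefore vanish: if B has coefficients b_0, ..., b_(m-1), then b_0 = e b_1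
    and b_(m-2) = e b_(m-1), so b_0 b_(m-2) + b_1 b_(m-1) = 2 b_1 b_(m-1) is
    nonzero, whereas it is the linear coefficient of B B*, which is zero by the
    second identity ([half_polynomial_absurd]).  Hence m = 2. *)

(** * Alternating and reversed polynomials *)

Section PolyTools.

Variable R : comNzRingType.
Implicit Types p q : {poly R}.

Lemma coef_comp_polyNX p i : (p \Po - 'X)`_i = (-1) ^+ i * p`_i.
Proof.
suff -> : p \Po - 'X = \poly_(j < size p) ((-1) ^+ j * p`_j).
  by rewrite coef_poly; case: ltnP => // ?; rewrite [p`_i]nth_default ?mulr0.
rewrite comp_polyE poly_def; apply: eq_bigr => j _.
by rewrite [in LHS]exprNn -!mul_polyC polyCM rmorphXn /= polyCN; ring.
Qed.

Lemma comp_polyNXK p : (p \Po - 'X) \Po - 'X = p.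
Proof.
apply/polyP=> i; rewrite !coef_comp_polyNX mulrA -expr2 -exprM muln2.
by rewrite -signr_odd odd_double expr0 mul1r.
Qed.

Lemma comp_polyNX_Xn k : ~~ odd k -> 'X^k \Po - 'X = 'X^k :> {poly R}.
Proof. by move=> ko; rewrite comp_Xn_poly exprNn -signr_odd (negbTE ko) mul1r. Qed.

(** The reciprocal polynomial 'X^N p(1/X), relative to a nominal degree [N]
    that may exceed the degree of [p]; fixing [N] keeps the operation linear
    and multiplicative even when end coefficients vanish. *)
Definition rev_poly (N : nat) p : {poly R} := \poly_(i < N.+1) p`_(N - i).

Lemma coef_rev_poly N p i :
  (rev_poly N p)`_i = if (i <= N)%N then p`_(N - i) else 0.
Proof. by rewrite coef_poly ltnS. Qed.

Lemma size_rev_poly N p : (size (rev_poly N p) <= N.+1)%N.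
Proof. exact: size_poly. Qed.

Lemma rev_polyK N p : (size p <= N.+1)%N -> rev_poly N (rev_poly N p) = p.
Proof.
move=> sp; apply/polyP=> i; rewrite !coef_rev_poly leq_subr.
case: leqP => iN; first by rewrite subKn.
by rewrite nth_default //; apply: leq_trans sp iN.
Qed.

Lemma rev_poly_sum N I (r : seq I) (F : I -> {poly R}) :
  rev_poly N (\sum_(i <- r) F i) = \sum_(i <- r) rev_poly N (F i).
Proof.
apply/polyP=> i; rewrite coef_rev_poly !coef_sum.
under [RHS]eq_bigr do rewrite coef_rev_poly.
by case: leqP => // _; rewrite big1.
Qed.

Lemma rev_polyZ N c p : rev_poly N (c *: p) = c *: rev_poly N p.
Proof.
apply/polyP=> i; rewrite coefZ !coef_rev_poly coefZ.
by case: leqP => // _; rewrite mulr0.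
Qed.

Lemma rev_polyZXn N c i : (i <= N)%N ->
  rev_poly N (c *: 'X^i) = c *: 'X^(N - i).
Proof.
move=> iN; apply/polyP=> j; rewrite coef_rev_poly !coefZ !coefXn.
case: leqP => jN; first by congr (_ * (nat_of_bool _)%:R); lia.
by rewrite (_ : (j == _) = false) ?mulr0 //; lia.
Qed.

Lemma rev_polyM k l p q : (size p <= k.+1)%N -> (size q <= l.+1)%N ->
  rev_poly (k + l) (p * q) = rev_poly k p * rev_poly l q.
Proof.
have E N (r : {poly R}) : (size r <= N.+1)%N -> r = \sum_(i < N.+1) r`_i *: 'X^i.
  move=> sr; rewrite -(poly_def N.+1 (fun i => r`_i)).
  apply/polyP=> i; rewrite coef_poly.
  by case: ltnP => // iN; rewrite nth_default //; apply: leq_trans sr iN.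
move=> /E-> /E->; rewrite big_distrl /= !rev_poly_sum big_distrl /=.
apply: eq_bigr => i _; rewrite !big_distrr /= rev_poly_sum.
apply: eq_bigr => j _; rewrite -!(scalerAl, scalerAr) !scalerA -!exprD.
have := ltn_ord i; have := ltn_ord j => jl ik.
rewrite !rev_polyZXn; [|lia..].
rewrite -!(scalerAl, scalerAr) !scalerA -!exprD.
by congr (_ *: 'X^_); lia.
Qed.

End PolyTools.

(** * Coprime factors of a square *)

Section CoprimeSquare.

Variable F : fieldType.
Implicit Types u v w : {poly F}.

(** With g = gcd(u, w), u = u' g and w = w' g, cancelling g in u v = w^2 gives
    u' v = g w'^2.  Coprimality of u' and w' forces u' | g, and coprimality of g
    and v forces g | u'; so u' is g up to a constant. *)
Lemma coprime_factor_square u v w :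
  w != 0 -> coprimep u v -> u * v = w ^+ 2 ->
  exists2 g, g %| w & exists c, u = c *: g ^+ 2.
Proof.
move=> w0 cuv uvw; set g := gcdp u w.
exists g; first exact: dvdp_gcdr.
have g0 : g != 0 by rewrite gcdp_eq0 negb_and w0 orbT.
have uE : u = (u %/ g) * g by rewrite divpK ?dvdp_gcdl.
have wE : w = (w %/ g) * g by rewrite divpK ?dvdp_gcdr.
have cop : coprimep (u %/ g) (w %/ g).
  by apply: coprimep_div_gcd; rewrite w0 orbT.
set u' := u %/ g in uE cop; set w' := w %/ g in wE cop.
have E : u' * v = g * w' ^+ 2.
  by apply: (mulIf g0); rewrite mulrAC -uE uvw [in LHS]wE; ring.
have ug : u' %| g.
  by rewrite -(Gauss_dvdpl _ (coprimep_expr 2 cop)) -E dvdp_mulr.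
have gu : g %| u'.
  have cgv : coprimep g v := coprimep_dvdr (dvdp_gcdl u w) cuv.
  by rewrite -(Gauss_dvdpl _ cgv) E dvdp_mulr.
have /eqpP[[c1 c2] /= /andP[c10 c20] Ec] : u' %= g by rewrite /eqp ug gu.
exists (c1^-1 * c2); rewrite uE expr2 scalerAl -scalerA -Ec scalerA mulVf //.
by rewrite scale1r.
Qed.

End CoprimeSquare.

(** Gauss's lemma makes the square root integral, since it divides w.  The
    normalisation of [w] at 0 makes the constant term of the root a unit, and
    this identifies the scalar as the constant term of [u]. *)
Lemma int_coprime_factor_square (u v w : {poly int}) :
  coprimep (map_poly (intr : int -> rat) u) (map_poly intr v) ->
  u * v = w ^+ 2 -> w`_0 = 1 -> exists g : {poly int}, u = u`_0 *: g ^+ 2.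
Proof.
move=> cuv uvw w01.
have w0 : w != 0 by apply: contra_eq_neq w01 => ->; rewrite coef0.
have mI : injective (map_poly (intr : int -> rat)).
  by apply: map_inj_poly => //; exact: intr_inj.
have [||G /dvdpP_rat_int[g [d d0 ->] [r wE]] [c uE]] :=
  @coprime_factor_square _ _ _ (map_poly (intr : int -> rat) w) _ cuv.
- by rewrite map_poly_eq0_id0 // intr_eq0 lead_coef_eq0.
- by rewrite -rmorphM uvw rmorphXn.
have g0 : g`_0 ^+ 2 = 1.
  have := congr1 absz w01; rewrite wE coef0M abszM => /eqP.
  rewrite muln_eq1 => /andP[/eqP g01 _].
  by have [->|->] : g`_0 = 1 \/ g`_0 = -1 by lia.
have u0E : (u`_0)%:~R = c * (d * d).
  have := congr1 (fun p : {poly rat} => p`_0) uE.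
  rewrite /= coef_map /= exprZn !coefZ !expr2 coef0M !coef_map /=.
  by rewrite -intrM -[g`_0 * _]expr2 g0 mulr1.
exists g; apply: mI; rewrite linearZ_LR /= rmorphXn /= u0E uE.
by rewrite exprZn [in LHS]expr2 scalerA.
Qed.

(** The quadratic coefficient of g^2 is 2 g_0 g_2 + g_1^2: if it is even, so is
    g_1, and then 4 divides the linear coefficient 2 g_0 g_1. *)
Lemma sqr_poly_coef1_mod4 (g : {poly int}) :
  (exists s, (g ^+ 2)`_2 = 2 * s) -> exists t, (g ^+ 2)`_1 = 4 * t.
Proof.
rewrite expr2 !coefM !big_ord_recl !big_ord0 /= !subn0 /bump /= => -[s].
move: (g`_0) (g`_1) (g`_2) => x y z E.
have [t ->] : exists t, y = 2 * t.
  have y2 : y = 2 * (y %/ 2)%Z \/ y = 2 * (y %/ 2)%Z + 1 by lia.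
  case: y2 => y2; first by exists (y %/ 2)%Z.
  exfalso; move: E; rewrite y2; set q := (_ %/ _)%Z; nia.
by exists (x * t); ring.
Qed.

(** * Autocorrelations modulo 4 and the mirror symmetry *)

Definition sign (x : int) : Prop := x = 1 \/ x = -1.

Lemma signM (x y : int) : sign x -> sign y -> sign (x * y).
Proof. by rewrite /sign; case=> ->; case=> ->; lia. Qed.

(** Induction on N: (1 - P)(1 - x) is divisible by 4 for signs P and x, so
    multiplying the product by x changes it by x - 1 modulo 4. *)
Lemma sum_signs_mod4 (N : nat) (x : nat -> int) :
  (forall i, (i < N)%N -> sign (x i)) ->
  sign (\prod_(0 <= i < N) x i) /\
  exists t : int,
    \sum_(0 <= i < N) x i = N%:Z - 1 + \prod_(0 <= i < N) x i + 4 * t.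
Proof.
elim: N => [|N IHN] xS.
  by rewrite !big_geq //; split; [left | exists 0; lia].
have [|PS [t St]] := IHN; first by move=> i iN; apply: xS; lia.
have xNS := xS N (ltnSn N).
rewrite !big_nat_recr //= St; split; first exact: signM.
case: PS => ->; case: xNS => ->;
  first [by exists t; lia | by exists (t + 1); lia | by exists (t - 1); lia].
Qed.

Section Reflection.

Variables (n : nat) (a : n.-tuple int).
Hypothesis a_sign : forall i, (i < n)%N -> sign a`_i.

Definition lag_product (k : nat) : int :=
  \prod_(0 <= j < n - k) (a`_j * a`_(j + k)%N).

Lemma autocorrelation_mod4 (k : nat) : (k <= n)%N ->
  sign (lag_product k) /\
  exists t : int,
    autocorrelation a k = n%:Z - k%:Z - 1 + lag_product k + 4 * t.
Proof.
move=> kn.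
have [|PS [t St]] := @sum_signs_mod4 (n - k) (fun j => a`_j * a`_(j + k)%N).
  by move=> i ink; apply: signM; apply: a_sign; lia.
by split=> //; exists t; rewrite /autocorrelation St /lag_product; lia.
Qed.

Lemma autocorrelation0 : autocorrelation a 0 = n%:Z.
Proof.
rewrite /autocorrelation subn0 (eq_big_nat _ _ (F2 := fun=> 1)).
  by rewrite big_const_nat subn0 iter_addr_0 natz.
by move=> i /andP[_ /a_sign]; rewrite addn0; case=> ->.
Qed.

Lemma lag_productS (k : nat) : (k < n)%N ->
  lag_product k = a`_k * a`_(n.-1 - k) * lag_product k.+1.
Proof.
move=> kn; rewrite /lag_product !big_split /=.
have -> : (n - k = (n.-1 - k).+1)%N by lia.
rewrite big_nat_recr //= [X in _ * X = _]big_nat_recl //= add0n.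
rewrite (_ : (n - k.+1 = n.-1 - k)%N); last by lia.
under [X in _ * (_ * X) = _]eq_bigr do rewrite addSnnS.
by ring.
Qed.

(** Together, the lags k and n - k pair every index with its cyclic shift, so
    the two products multiply to the square of the product of all entries. *)
Lemma lag_product_opp (k : nat) : (k <= n)%N ->
  lag_product (n - k) = lag_product k.
Proof.
move=> kn.
have E j : (j <= n)%N -> lag_product j =
    (\prod_(0 <= i < n - j) a`_i) * \prod_(j <= i < n) a`_i.
  move=> jn; rewrite /lag_product big_split /=; congr (_ * _).
  by rewrite [RHS](_ : _ = \prod_(0 + j <= i < n) a`_i) // big_addn.
have [Pk _] := autocorrelation_mod4 kn.
have [|Pnk _] := @autocorrelation_mod4 (n - k); first by lia.
have full j : (j <= n)%N -> (\prod_(0 <= i < j) a`_i) * (\prod_(j <= i < n) a`_i)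
    = \prod_(0 <= i < n) a`_i by move=> jn; rewrite -big_cat_nat.
have sq : lag_product (n - k) * lag_product k = (\prod_(0 <= i < n) a`_i) ^+ 2.
  rewrite !E //; last by lia.
  rewrite subKn // expr2 -{1}(full k) // -(full (n - k)%N); last by lia.
  by ring.
have [|fullS _] := @sum_signs_mod4 n (fun i => a`_i) => //.
by move: sq; case: fullS => ->; case: Pk => ->; case: Pnk => ->; lia.
Qed.

Hypotheses (n_even : ~~ odd n) (n_ge4 : (4 <= n)%N).
Hypothesis C_small : forall k, (0 < k < n)%N -> -1 <= autocorrelation a k <= 1.

(** [autocorrelation_mod4] makes C_k even here, and |C_k| <= 1. *)
Lemma autocorrelation_even (k : nat) :
  ~~ odd k -> (0 < k < n)%N -> autocorrelation a k = 0.
Proof.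
move=> ko kn; have := C_small kn.
have [|PS [t ->]] := @autocorrelation_mod4 k; first by lia.
by case: PS => ->; lia.
Qed.

(** Both C_2 and C_(n-2) vanish and their lag products agree, so adding the two
    congruences of [autocorrelation_mod4] gives n = 0 modulo 4. *)
Lemma dvd4_length : (4 %| n)%N.
Proof.
have C2 : autocorrelation a 2 = 0 by apply: autocorrelation_even; lia.
have Cn2 : autocorrelation a (n - 2) = 0 by apply: autocorrelation_even; lia.
have [|P2 [t]] := @autocorrelation_mod4 2; first by lia.
have [|Pn2 [u]] := @autocorrelation_mod4 (n - 2); first by lia.
rewrite C2 Cn2 lag_product_opp; last by lia.
by case: P2 => ->; lia.
Qed.

(** As the lag products at k and n - k agree, C_k + C_(n-k) = n modulo 4; this
    is 0 by [dvd4_length], and the sum is at most 2 in absolute value. *)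
Lemma autocorrelation_opp (k : nat) : (0 < k < n)%N ->
  autocorrelation a (n - k) = - autocorrelation a k.
Proof.
move=> kn; have := C_small kn.
have := @C_small (n - k) ltac:(lia).
have [|P [t ->]] := @autocorrelation_mod4 k; first by lia.
have [|_ [u ->]] := @autocorrelation_mod4 (n - k); first by lia.
have := dvd4_length.
rewrite lag_product_opp; last by lia.
by case: P => ->; lia.
Qed.

Variable c : int.
Hypothesis C_odd : forall k, odd k -> (k < n./2)%N -> autocorrelation a k = c.

Lemma c_sign : sign c.
Proof.
have C1 : autocorrelation a 1 = c by apply: C_odd; lia.
have := @C_small 1 ltac:(lia); rewrite C1 /sign.
have [|P [t]] := @autocorrelation_mod4 1; first by lia.
by rewrite C1; case: P => ->; lia.
Qed.

(** By [lag_productS] the product of the two mirrored entries is a ratio of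
    consecutive lag products, each known modulo 4 from C_k and C_(k+1).  One of
    these autocorrelations is c; the other is 0, or n when k = 0. *)
Lemma reflection (k : nat) : (k < n./2)%N ->
  a`_(n.-1 - k) = - c * (-1) ^+ k * a`_k.
Proof.
move=> km.
have := @lag_productS k ltac:(lia).
have [|P [t]] := @autocorrelation_mod4 k; first by lia.
have [|PS [u]] := @autocorrelation_mod4 k.+1; first by lia.
have n4 := dvd4_length.
have ak := @a_sign k ltac:(lia).
have ank := @a_sign (n.-1 - k) ltac:(lia).
have cS := c_sign.
rewrite -signr_odd; case ko: (odd k).
  rewrite (C_odd ko) // autocorrelation_even //; try lia.
  rewrite expr1; case: P => ->; case: PS => ->; case: cS => ->;
  case: ak => ->; case: ank => ->; lia.
rewrite expr0 (@C_odd k.+1); [|lia|lia].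
have Ck : (exists v : int, autocorrelation a k = 4 * v).
  have [->|k0] := posnP k; last by exists 0; apply: autocorrelation_even; lia.
  by exists (n %/ 4)%N; rewrite autocorrelation0; lia.
case: Ck => v ->.
case: P => ->; case: PS => ->; case: cS => ->;
case: ak => ->; case: ank => ->; lia.
Qed.

End Reflection.

(** * The two identities for the half polynomial are incompatible *)

Section HalfPolynomial.

Variables (m : nat) (B : {poly int}).
Hypotheses (m_even : ~~ odd m) (m_gt2 : (2 < m)%N).
Hypothesis size_B : (size B <= m)%N.
Hypothesis B_sign : forall j, (j < m)%N -> sign B`_j.

Let BN := B \Po - 'X.
Let Br := rev_poly m.-1 B.

Hypothesis B_mulN : (1 - 'X^2) * (B * BN) = (1 - 'X^m) ^+ 2.
Hypothesis B_mulr :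
  B * Br - ((B * Br) \Po - 'X) = (2 * m%:Z) *: 'X^(m.-1).

(** 1 - X^2 divides 1 - X^m, so cancelling it once from [B_mulN] leaves
    B(X) B(-X) with a factor 1 - X^m, which vanishes at 1. *)
Lemma half_root : exists2 e : int, sign e & B.[e] = 0.
Proof.
have S : 1 - 'X^m = (1 - 'X^2) * \sum_(i < m./2) ('X^2) ^+ i :> {poly int}.
  rewrite -[1 - 'X^m]opprB -[1 - 'X^2]opprB mulNr -subrX1 -exprM.
  by congr (- ('X^_ - 1)); lia.
have n0 : 1 - 'X^2 != 0 :> {poly int}.
  apply/eqP => /(congr1 (fun p : {poly int} => p`_0)).
  by rewrite coefB coef1 coefXn coef0.
have : (B * BN).[1] = 0.
  have -> : B * BN = (1 - 'X^m) * \sum_(i < m./2) ('X^2) ^+ i.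
    by apply: (mulfI n0); rewrite B_mulN expr2 {1}S; ring.
  by rewrite hornerM hornerD hornerN hornerXn hornerC expr1n subrr mul0r.
rewrite hornerM horner_comp hornerN hornerX => /eqP.
rewrite mulf_eq0 => /orP[] /eqP E; first by exists 1 => //; left.
by exists (-1) => //; right.
Qed.

Lemma half_rootN (e : int) : sign e -> B.[e] = 0 -> B.[- e] != 0.
Proof.
move=> eS Be; apply/eqP => BNe.
have := congr1 (fun p : {poly int} => p.[e]) B_mulr.
rewrite /= hornerD hornerN horner_comp !hornerM hornerN hornerX Be BNe.
rewrite hornerZ hornerXn !mul0r subr0 => /esym/eqP.
by rewrite mulf_eq0 expf_eq0; case: eS => ->; lia.
Qed.

Local Notation toQ := (map_poly (intr : int -> rat)).

(** By [B_mulr] a common divisor of B(X) and B(-X) divides a power of X, and B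
    has a nonzero constant term; so B(X) and B(-X) are coprime.  The linear
    factors X - e and -(X + e) keep this, as B(-e) and e are nonzero. *)
Lemma half_coprime (e : int) : sign e -> B.[e] = 0 ->
  coprimep (toQ (B * ('X - e%:P))) (toQ ((B * ('X - e%:P)) \Po - 'X)).
Proof.
move=> eS Be; have BNe := half_rootN eS Be.
have -> : (B * ('X - e%:P)) \Po - 'X = -1 *: (BN * ('X - (- e)%:P)).
  rewrite comp_polyM comp_polyB comp_polyX comp_polyC -/BN polyCN scaleN1r; ring.
have root_toQ p x : root (toQ p) x%:~R = (p.[x] == 0).
  by rewrite rootE horner_map /= intr_eq0.
have B0 := @B_sign 0 ltac:(lia).
have cop : coprimep (toQ B) (toQ BN).
  set g := gcdp (toQ B) (toQ BN).
  have gX : g %| 'X^(m.-1).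
    have n0 : (2 * m%:Z)%:~R != 0 :> rat by rewrite intr_eq0; lia.
    rewrite -(dvdpZr _ _ n0).
    have := congr1 toQ B_mulr.
    rewrite linearZ /= map_polyXn => <-.
    rewrite comp_polyM rmorphB !rmorphM dvdp_sub // dvdp_mulr //.
      exact: dvdp_gcdl.
    exact: dvdp_gcdr.
  have BX : coprimep (toQ B) 'X^(m.-1).
    rewrite coprimep_expr // coprimepX -[0]/(0%:~R) root_toQ horner_coef0.
    by case: B0 => ->.
  have := coprimep_dvdl gX (coprimep_dvdr (dvdp_gcdl _ (toQ BN)) BX).
  by rewrite coprimepp /coprimep.
rewrite linearZ /= !rmorphM /= !rmorphB /= !map_polyX !map_polyC /=.
rewrite coprimepZr ?oppr_eq0 ?oner_eq0 // coprimepMl !coprimepMr cop /=.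
rewrite coprimep_XsubC2; last by rewrite -intrB intr_eq0; case: eS => ->.
rewrite coprimep_XsubC root_toQ BNe /= andbT.
rewrite coprimep_sym coprimep_XsubC root_toQ horner_comp hornerN hornerX.
exact: BNe.
Qed.

(** U = (X - e) B is up to sign the square of an integer polynomial, and so is
    its reciprocal; [sqr_poly_coef1_mod4] then kills the two outermost inner
    coefficients of U. *)
Lemma half_polynomial_absurd : False.
Proof.
have [e eS Be] := half_root.
set U := B * ('X - e%:P).
have UUN : U * (U \Po - 'X) = (1 - 'X^m) ^+ 2.
  rewrite -B_mulN /U comp_polyM comp_polyB comp_polyX comp_polyC -/BN.
  have e2 : e%:P * e%:P = 1 :> {poly int} by rewrite -polyCM; case: eS => ->.
  by ring: e2.
have [g UE] : exists g, U = U`_0 *: g ^+ 2.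
  apply: int_coprime_factor_square (half_coprime eS Be) UUN _.
  by rewrite coefB coef1 coefXn; case: m m_gt2.
have sU : (size U <= m.+1)%N.
  apply: leq_trans (size_polyMleq _ _) _; rewrite size_XsubC addn2 /=.
  exact: size_B.
have coefU j : U`_j.+1 = B`_j - e * B`_j.+1.
  by rewrite /U mulrBr coefB coefMX coefMC mulrC.
have U0S : sign U`_0.
  rewrite /U mulrBr coefB coefMX coefMC sub0r.
  have := @B_sign 0 ltac:(lia); rewrite /sign.
  by case: eS => ->; case=> ->; lia.
clearbody U.
(* A multiple of 4 in {-2, 0, 2} is 0. *)
have key (g' : {poly int}) : U`_0 * (g' ^+ 2)`_2 \in [:: -2; 0; 2] ->
    U`_0 * (g' ^+ 2)`_1 \in [:: -2; 0; 2] -> U`_0 * (g' ^+ 2)`_1 = 0.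
  have := @sqr_poly_coef1_mod4 g'; move: (g' ^+ 2)`_1 (g' ^+ 2)`_2 => x y H.
  rewrite !inE => Hy Hx; case: H => [|t]; last first.
    by case: U0S => U0; rewrite U0 in Hx Hy *; lia.
  by exists (y %/ 2)%Z; case: U0S => U0; rewrite U0 in Hx Hy; lia.
have U_mid j : (0 < j < m)%N -> U`_j \in [:: -2; 0; 2].
  case: j => // j jm; rewrite coefU !inE.
  have := @B_sign j ltac:(lia); have := @B_sign j.+1 ltac:(lia).
  by case: eS => ->; case=> ->; case=> ->.
have U1 : U`_1 = 0.
  rewrite UE coefZ; apply: key; rewrite -coefZ -UE; apply: U_mid; lia.
have rU : rev_poly m U = U`_0 *: rev_poly m./2 g ^+ 2.
  have sg : (size g <= m./2.+1)%N.
    have U0 : U`_0 != 0 by case: U0S => ->.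
    have := sU; rewrite UE size_scale // expr2.
    have [->|g0] := eqVneq g 0; first by rewrite size_poly0.
    rewrite size_mul //; move: (size g) => s; lia.
  have m2 : m = (m./2 + m./2)%N by lia.
  by rewrite {1}UE rev_polyZ [in LHS]m2 !expr2 rev_polyM.
have Um1 : U`_m.-1 = 0.
  have rU1 : U`_m.-1 = (rev_poly m U)`_1.
    by rewrite coef_rev_poly subn1; case: ifP => //; lia.
  have rU2 : U`_(m - 2) = (rev_poly m U)`_2.
    by rewrite coef_rev_poly; case: ifP => //; lia.
  rewrite rU1 rU coefZ.
  by apply: key; rewrite -coefZ -rU -?rU2 -?rU1; apply: U_mid; lia.
(* Linear coefficients: b_0 b_(m-2) + b_1 b_(m-1) = 0 because m - 1 <> 1. *)
have := congr1 (fun p : {poly int} => p`_1) B_mulr.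
rewrite /= coefB coef_comp_polyNX coefZ coefXn.
rewrite (_ : (1 == m.-1)%N = false); last by lia.
rewrite coefM !big_ord_recl big_ord0 /= /bump /= !coef_rev_poly.
rewrite subn0 subn1.
move: U1 Um1; rewrite (_ : m.-1 = m.-2.+1); last by lia.
rewrite !coefU => /eqP + /eqP.
rewrite !subr_eq0 /= !subSS subn0 => /eqP-> /eqP->.
have := @B_sign 1 ltac:(lia); have := @B_sign m.-2.+1 ltac:(lia).
by case: eS => ->; case=> ->; case=> ->; lia.
Qed.

End HalfPolynomial.

(** * Folding a mirror-symmetric polynomial onto its first half *)

Section Folding.

Variables (m : nat) (A : {poly int}) (s : int).
Hypotheses (m_even : ~~ odd m) (m_gt0 : (0 < m)%N) (s_sign : sign s).
Hypothesis size_A : (size A <= 2 * m)%N.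
Hypothesis A_refl : forall k, (k < m)%N ->
  A`_((2 * m).-1 - k) = s * (-1) ^+ k * A`_k.

Let B := take_poly m A.
Let BN := B \Po - 'X.
Let Br := rev_poly m.-1 B.
Let BrN := Br \Po - 'X.
Let P := A * rev_poly (2 * m).-1 A.

(** Reading the second half upwards reverses B, and the mirror index k runs
    downwards from m - 1, which is odd: hence the minus sign. *)
Lemma fold_poly : A = B - s *: ('X^m * BrN).
Proof.
apply/polyP=> i; rewrite coefB coefZ coefXnM coef_comp_polyNX coef_rev_poly.
rewrite !coef_take_poly; case: ltnP => im; first by rewrite mulr0 subr0.
case: (leqP (i - m) m.-1) => im2; last first.
  by rewrite !mulr0 subr0 nth_default //; apply: leq_trans size_A _; lia.
rewrite ifT; last by lia.
have := @A_refl (m.-1 - (i - m)) ltac:(lia).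
rewrite (_ : ((2 * m).-1 - _ = i)%N) => [->|]; last by lia.
rewrite -signr_odd -[in RHS]signr_odd.
have -> : odd (m.-1 - (i - m)) = ~~ odd (i - m) by lia.
by case: odd; rewrite /= ?expr0 ?expr1; ring.
Qed.

Lemma fold_rev_poly : rev_poly (2 * m).-1 A = s *: BN + 'X^m * Br.
Proof.
apply/polyP=> i; rewrite coefD coefZ coefXnM coef_comp_polyNX !coef_rev_poly.
rewrite !coef_take_poly; case: (ltnP i m) => im.
  by rewrite ifT ?A_refl // ?addr0 ?mulrA //; lia.
rewrite !mulr0 add0r; case: (leqP i (2 * m).-1) => im2; last by rewrite ifF //; lia.
by rewrite !ifT; [congr A`_(_) | ..]; lia.
Qed.

(** Expand the product of the two folded forms, using s^2 = 1.  The two terms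
    with a factor s are even polynomials and the middle one is odd, so the
    parities of the exponents separate them. *)
Lemma fold_correlation :
  P = s *: (B * BN) + 'X^m * (B * Br - ((B * Br) \Po - 'X))
      - s *: ('X^m * 'X^m * (Br * BrN)).
Proof.
rewrite /P fold_rev_poly {1}fold_poly comp_polyM -/BN -/BrN -!mul_polyC.
have s2 : s%:P * s%:P = 1 :> {poly int} by rewrite -polyCM; case: s_sign => ->.
by ring: s2.
Qed.

Lemma fold_correlation_odd :
  P - (P \Po - 'X) = 2 *: ('X^m * (B * Br - ((B * Br) \Po - 'X))).
Proof.
rewrite fold_correlation !(comp_polyB, comp_polyD, comp_polyZ, comp_polyM).
rewrite comp_polyNX_Xn // !comp_polyNXK -/BN -/BrN -!mul_polyC.
by rewrite (_ : 2%:P = 2%:R :> {poly int}) ?rmorph_nat //; ring.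
Qed.

Lemma coef_fold_correlation_even e : ~~ odd e -> (e < 2 * m)%N ->
  P`_e = s * (B * BN)`_e.
Proof.
move=> eo em; rewrite fold_correlation coefB coefD !coefZ -exprD !coefXnM.
rewrite [X in _ - _ * X]ifT; last by lia.
rewrite mulr0 subr0.
case: ltnP => me; rewrite ?addr0 // coefB coef_comp_polyNX -signr_odd.
by rewrite (_ : odd _ = false) ?expr0 ?mul1r ?subrr ?addr0 //; lia.
Qed.

End Folding.

(** * The half polynomial of a Barker sequence *)

Section Correlation.

Variables (n : nat) (a : n.-tuple int).
Let A : {poly int} := Poly a.
Let P := A * rev_poly n.-1 A.

Lemma size_tuple_poly : (size A <= n)%N.
Proof. by rewrite -[X in (_ <= X)%N](size_tuple a) size_Poly. Qed.

Lemma coef_correlation k : (k < n)%N -> P`_(n.-1 - k) = autocorrelation a k.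
Proof.
move=> kn; rewrite /autocorrelation big_mkord coefM.
rewrite (_ : (n - k = (n.-1 - k).+1)%N); last by lia.
apply: eq_bigr => i _; rewrite coef_rev_poly !coef_Poly ifT; last by lia.
by congr (_ * a`_(_)); have := ltn_ord i; lia.
Qed.

Lemma coef_correlation_sym i : (0 < n)%N -> (i <= n.-1 + n.-1)%N ->
  P`_(n.-1 + n.-1 - i) = P`_i.
Proof.
move=> n0 iN.
have sA : (size A <= n.-1.+1)%N by rewrite prednK // size_tuple_poly.
have {2}-> : P = rev_poly (n.-1 + n.-1) P.
  by rewrite rev_polyM ?size_rev_poly // rev_polyK // mulrC.
by rewrite coef_rev_poly iN.
Qed.

End Correlation.

Section Barker.

Variables (n : nat) (a : n.-tuple int).
Hypothesis a_sign : forall i, (i < n)%N -> sign a`_i.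
Hypotheses (n_even : ~~ odd n) (n_ge4 : (4 <= n)%N).
Hypothesis C_small : forall k, (0 < k < n)%N -> -1 <= autocorrelation a k <= 1.
Variable c : int.
Hypothesis C_odd : forall k, odd k -> (k < n./2)%N -> autocorrelation a k = c.

Let A : {poly int} := Poly a.
Let m := n./2.
Let P := A * rev_poly n.-1 A.
Let B := take_poly m A.
Let BN := B \Po - 'X.
Let Br := rev_poly m.-1 B.

Lemma barker_lengthE : n = (2 * m)%N. Proof. by rewrite /m; lia. Qed.

Lemma barker_half_even : ~~ odd m.
Proof. have := dvd4_length a_sign n_even n_ge4 C_small; rewrite /m; lia. Qed.

Lemma barker_refl k : (k < m)%N ->
  A`_((2 * m).-1 - k) = - c * (-1) ^+ k * A`_k.
Proof.
rewrite -barker_lengthE !coef_Poly.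
exact: (reflection a_sign n_even n_ge4 C_small C_odd).
Qed.

Lemma barker_c_sign : sign c.
Proof. exact: (c_sign a_sign n_even n_ge4 C_small C_odd). Qed.

Lemma barker_s_sign : sign (- c).
Proof. by case: barker_c_sign => ->; [right | left]. Qed.

Lemma barker_size_A : (size A <= 2 * m)%N.
Proof. by rewrite -barker_lengthE size_tuple_poly. Qed.

(** The exponents n - 1 +- k are odd exactly when k is even, and C_0 = n is the
    only nonzero autocorrelation of even lag. *)
Lemma barker_correlation_odd : P - (P \Po - 'X) = (2 * n%:Z) *: 'X^(n.-1).
Proof.
apply/polyP=> i; rewrite coefB coef_comp_polyNX coefZ coefXn -signr_odd.
case io: (odd i); last first.
  by rewrite expr0 mul1r subrr (_ : (i == _) = false) ?mulr0 //; lia.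
suff -> : P`_i = n%:Z * (i == n.-1)%:R by ring.
have low j : odd j -> (j <= n.-1)%N -> P`_j = n%:Z * (j == n.-1)%:R.
  move=> jo jn; rewrite (_ : j = n.-1 - (n.-1 - j))%N; last by lia.
  rewrite coef_correlation; last by lia.
  have [->|jn1] := eqVneq j n.-1.
    by rewrite !subnn subn0 eqxx mulr1 autocorrelation0.
  rewrite (autocorrelation_even a_sign n_even n_ge4 C_small); [|lia..].
  by rewrite (_ : (_ == _) = false) ?mulr0 //; lia.
case: (leqP i n.-1) => iN; first exact: low.
rewrite (_ : (i == n.-1) = false) ?mulr0; last by lia.
case: (leqP i (n.-1 + n.-1)) => iN2.
  rewrite -coef_correlation_sym //; last by lia.
  by rewrite low; [|lia..]; rewrite (_ : (_ == _) = false) ?mulr0 //; lia.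
have := size_rev_poly n.-1 A; have := size_tuple_poly a; rewrite -/A => sA sr.
rewrite nth_default //; apply: leq_trans (size_polyMleq _ _) _.
move: (size A) (size (rev_poly _ _)) sA sr => x y; lia.
Qed.

Lemma barker_mulr : B * Br - ((B * Br) \Po - 'X) = (2 * m%:Z) *: 'X^(m.-1).
Proof.
have := fold_correlation_odd barker_half_even _ barker_s_sign
    barker_size_A barker_refl.
rewrite -barker_lengthE -/P -/B -/Br barker_correlation_odd => /(_ ltac:(lia)) E.
have X0 : 2 *: 'X^m != 0 :> {poly int}.
  by rewrite -size_poly_eq0 size_scale // size_polyXn.
apply: (mulfI X0); rewrite -scalerAl -E -scalerAl -scalerAr scalerA -exprD.
by congr (_ *: 'X^_); have := barker_lengthE; lia.
Qed.

(** The coefficient of B(X) B(-X) at an even e < n is - c C_(n-1-e), which is 1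
    for e < m and -1 for e >= m; these are the coefficients of
    (1 - X^m) (1 + X^2 + ... + X^(m-2)). *)
Lemma barker_mulN : (1 - 'X^2) * (B * BN) = (1 - 'X^m) ^+ 2.
Proof.
have mE := barker_lengthE; have mo := barker_half_even.
have -> : B * BN = \poly_(e < 2 * m)
    (if odd e then 0 else if (e < m)%N then 1 else -1).
  apply/polyP=> e; rewrite coef_poly; case: ltnP => em; last first.
    have sB : (size B <= m)%N by exact: size_take_poly.
    have sBN : (size BN <= m)%N.
      apply/leq_sizeP => j mj; rewrite coef_comp_polyNX coef_take_poly.
      by rewrite ltnNge mj mulr0.
    rewrite nth_default //; apply: leq_trans (size_polyMleq _ _) _.
    by move: (size B) (size BN) sB sBN => x y; lia.
  case eo: (odd e).
    have E : (B * BN) \Po - 'X = B * BN.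
      by rewrite comp_polyM comp_polyNXK mulrC.
    have := congr1 (fun p : {poly int} => p`_e) E.
    by rewrite /= coef_comp_polyNX -signr_odd eo expr1; move: (_`_e) => x; lia.
  have := coef_fold_correlation_even barker_half_even _
    barker_s_sign barker_size_A barker_refl.
  rewrite -barker_lengthE -/P -/B -/BN => /(_ ltac:(lia) e ltac:(lia) ltac:(lia)).
  have -> : P`_e = autocorrelation a (n.-1 - e).
    by rewrite -coef_correlation; [congr P`_(_) |]; lia.
  move: (_`_e) => x.
  have cS := barker_c_sign.
  case: (ltnP e m) => em2.
    rewrite (_ : (n.-1 - e = n - e.+1)%N); last by lia.
    rewrite (autocorrelation_opp a_sign n_even n_ge4 C_small); last by lia.
    by rewrite C_odd; [case: cS => ->; lia | lia..].
  by rewrite C_odd; [case: cS => ->; lia | lia..].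
have -> : (1 - 'X^m) ^+ 2 = 1 - 2 *: 'X^m + 'X^(2 * m) :> {poly int}.
  by rewrite mul2n -addnn exprD -mul_polyC (_ : 2%:P = 2%:R) ?rmorph_nat //; ring.
apply/polyP=> e; rewrite mulrBl mul1r !(coefD, coefN).
rewrite coefXnM !coef_poly coef1 coefZ !coefXn.
do !case: ifP; lia.
Qed.

Lemma barker_length_eq4 : n = 4%N.
Proof.
have [m2|m2] := leqP m 2; first by have := barker_lengthE; lia.
exfalso; apply: (@half_polynomial_absurd m B) => //.
- exact: barker_half_even.
- exact: size_take_poly.
- move=> j jm; rewrite coef_take_poly jm coef_Poly.
  by apply: a_sign; have := barker_lengthE; lia.
- exact: barker_mulN.
- exact: barker_mulr.
Qed.

End Barker.

Local Close Scope ring_scope.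

Theorem theorem1 (n : nat) (a : n.-tuple int) (hn : 4 <= n)
    (hn_even : ~~ odd n) (ha : barker_sequence a)
    (hC : forall k l : nat,
        odd k -> 1 <= k <= n %/ 2 - 1 ->
        odd l -> 1 <= l <= n %/ 2 - 1 ->
        autocorrelation a k = autocorrelation a l) :
  n = 4.
Proof.
have [a_bin C_bark] := ha.
apply: (@barker_length_eq4 n a _ hn_even hn _ (autocorrelation a 1)).
- move=> i i_n; have : (a`_i)%R \in a by rewrite mem_nth // size_tuple.
  by move=> /a_bin; rewrite !inE => /orP[] /eqP ->; [right | left].
- move=> k kn; have := C_bark k ltac:(lia).
  by rewrite !inE => /or3P[] /eqP ->.
- by move=> k ko km; apply: hC; lia.
Qed.
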